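(* Let $p$ be an odd prime and $k\ge 1$. The extension group $B_k$, which has order $|B_k|=p^{k-1}$, is generated by $p+1$ modulo $p^k$. Moreover, each subgroup $S\subseteq B_k$, with $|S|=|B_k|/p^s$, satisfies $$\sum_{x\in S} x\equiv |S| \pmod{p^k}.$$
   Context: $p$ is an odd prime. $G_k$ is the multiplicative group of units modulo $p^k$, which is cyclic of order $(p-1)p^{k-1}$. The extension group $B_k$ is the subgroup of $G_k$ of order $p^{k-1}$, consisting of all residues $n$ modulo $p^k$ with $n\equiv 1 \pmod p$. *)

(* Defs.v *)
From mathcomp Require Import all_boot all_order all_algebra all_fingroup.
Set Implicit Arguments.
Unset Strict Implicit.
Unset Printing Implicit Defensive.

(* ['Z_(p ^ k)] is the ring of residues modulo p ^ k only when 1 < p ^ k, in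
   particular when p is prime and 0 < k; [units_Zp (p ^ k)] is then its unit group. *)
Definition extension_group (p k : nat) : {set {unit 'Z_(p ^ k)}} :=
  [set u in units_Zp (p ^ k) | (FinRing.uval u : nat) == 1 %[mod p]].

Lemma unit_Zp_le1 (n : nat) (u : {unit 'Z_n}) : n <= 1 -> u = 1%g.
Proof.
have uN0 : FinRing.uval u != 0%R.
  by apply: contraTneq (valP u) => u0; rewrite [val u]u0 GRing.unitr0.
by case: n u uN0 => [|[|n]] // [[[|[|m]] ltm] um] // _ _;
  apply: val_inj; apply: val_inj.
Qed.

Lemma extension_group_set (p k : nat) : group_set (extension_group p k).
Proof.
have one_in : 1%g \in extension_group p k by rewrite !inE /= eqxx.
apply/group_setP; split=> //.
move=> u v.
case: (leqP (p ^ k) 1) => [pk_le1 | pk_gt1].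
  by move=> _ _; rewrite (unit_Zp_le1 (u * v)%g pk_le1).
have p_dvd : p %| (Zp_trunc (p ^ k)).+2.
  by rewrite Zp_cast //; case: k pk_gt1 {u v one_in} => // k _;
    rewrite expnS dvdn_mulr.
rewrite !inE /= => /eqP up /eqP vp; apply/eqP.
by rewrite modn_dvdm // -modnMm up vp modnMm.
Qed.

Canonical extension_group_group (p k : nat) : {group {unit 'Z_(p ^ k)}} :=
  Group (extension_group_set p k).

(* Main.v *)
(** Lifting the exponent: for odd p and p | x, [p ^ k] divides
    [(1 + x) ^ (p ^ j) - 1] iff [p ^ (k - j)] divides [x].  Hence [p + 1] has
    order [p ^ (k - 1)], which is the number of residues congruent to 1 modulo
    p.  It also follows that a subgroup of order [p ^ j] consists of all the
    residues [1 + i p ^ (k - j)] with [i < p ^ j], whose sum is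
    [p ^ j + p ^ k (p ^ j - 1) / 2]. *)
Require Import Defs.
From mathcomp Require Import all_boot all_order all_algebra all_fingroup.
From mathcomp Require Import cyclic zify.
Set Implicit Arguments.
Unset Strict Implicit.
Unset Printing Implicit Defensive.

(** For odd [n], [n./2] is (n - 1) / 2; this form displays the factor [n]. *)
Lemma sum_ord_odd n : odd n -> \sum_(i < n) i = n * n./2.
Proof.
move=> n_odd; rewrite -(big_mkord xpredT id) bin2_sum bin2odd //.
by case: n n_odd => //= n; rewrite uphalf_half => /negbTE->.
Qed.

(** First-order binomial expansion; [c] collects the higher terms. *)
Lemma expSn_mod_sqr x i : exists c, x.+1 ^ i = 1 + i * x + c * x ^ 2.
Proof.
elim: i => [|i [c IHi]]; first by exists 0.
by exists (i + c + c * x); rewrite expnS IHi; nia.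
Qed.

Section LiftingTheExponent.

Variables (p : nat) (p_prime : prime p) (p_odd : odd p).

(** Modulo [p ^ 2] the sum is p + x p (p - 1) / 2. As [p] is odd, the second term is a multiple of p
    x, hence of [p ^ 2]. *)
Lemma logn_geometric_sum x : p %| x -> logn p (\sum_(i < p) x.+1 ^ i) = 1.
Proof.
case/dvdnP=> y ->.
have [c cE] : exists c, \sum_(i < p) (y * p).+1 ^ i = p + p * p * c.
  (* The number of terms is freed from [p], so that induction applies while the base stays fixed. *)
  have /(_ p)[c ->] n : exists c, \sum_(i < n) (y * p).+1 ^ i
      = n + (\sum_(i < n) i) * (y * p) + c * (y * p) ^ 2.
    elim: n => [|n [c IHn]]; first by exists 0; rewrite !big_ord0.
    have [d dE] := expSn_mod_sqr (y * p) n.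
    by exists (c + d); rewrite !big_ord_recr /= IHn dE;
      move: (\sum_(i < n) i) => t; nia.
  by rewrite sum_ord_odd //; exists (p./2 * y + c * y ^ 2); move: p./2 => h; nia.
have -> : \sum_(i < p) (y * p).+1 ^ i = p * (p * c).+1 by rewrite cE; nia.
have p_gt0 := prime_gt0 p_prime.
rewrite lognM // -{2}(expn1 p) pfactorK // logn_coprime //.
exact: coprime_dvdl (dvdn_mulr c (dvdnn p)) (coprimenS _).
Qed.

(** Since (1 + x) ^ p - 1 is [x] times the geometric sum, each [p]-th power raises the valuation by
    exactly one. *)
Lemma logn_expS_sub1 x j :
  0 < x -> p %| x -> logn p (x.+1 ^ (p ^ j) - 1) = logn p x + j.
Proof.
elim: j x => [|j IHj] x x_gt0 p_x.
  by rewrite expn0 expn1 subn1 addn0.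
pose y := x.+1 ^ p - 1.
have yE : y = x * \sum_(i < p) x.+1 ^ i.
  by rewrite /y subn1 predn_exp.
have yS : y.+1 = x.+1 ^ p by rewrite /y subn1 prednK // expn_gt0.
have sum_gt0 : 0 < \sum_(i < p) x.+1 ^ i.
  by case: (posnP (\sum_(i < p) x.+1 ^ i)) (logn_geometric_sum p_x) => // ->;
    rewrite logn0.
rewrite expnS expnM -yS IHj ?yE ?muln_gt0 ?x_gt0 ?dvdn_mulr //.
by rewrite lognM // logn_geometric_sum // addn1 addSnnS.
Qed.

Lemma dvdn_expS_sub1 k j x :
  p %| x -> (p ^ k %| x.+1 ^ (p ^ j) - 1) = (p ^ (k - j) %| x).
Proof.
(* The case [x = 0] is separate because [logn p 0] is 0 by convention. *)
move=> p_x; case: (posnP x) => [->|x_gt0]; first by rewrite exp1n subnn !dvdn0.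
have p_gt1 := prime_gt1 p_prime.
have pow_gt0 : 0 < x.+1 ^ (p ^ j) - 1.
  by rewrite subn_gt0 -(exp1n (p ^ j)) ltn_exp2r // expn_gt0 ltnW.
by rewrite !pfactor_dvdn // logn_expS_sub1 // leq_subLR addnC.
Qed.

End LiftingTheExponent.

Lemma eqr_nat_Zp n a b : 1 < n ->
  (a%:R == b%:R :> 'Z_n)%R = (a == b %[mod n]).
Proof. by move=> n_gt1; rewrite -val_eqE /= !val_Zp_nat. Qed.

Lemma unit_Zp_expg_eq1 n (u : {unit 'Z_n}) a m : 1 < n -> 0 < a ->
  FinRing.uval u = a%:R%R -> (u ^+ m == 1)%g = (n %| a ^ m - 1).
Proof.
move=> n_gt1 a_gt0 ua.
rewrite -(inj_eq val_inj) FinRing.val_unitX /= ua -GRing.natrX.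
by rewrite [LHS](eqr_nat_Zp _ 1) // eqn_mod_dvd // expn_gt0 a_gt0.
Qed.

Section ExtensionGroup.

Variables (p k : nat) (p_prime : prime p) (p_odd : odd p) (k_gt0 : 0 < k).
Implicit Type u : {unit 'Z_(p ^ k)}.

Let p_gt1 : 1 < p. Proof. exact: prime_gt1. Qed.
Let p_gt0 : 0 < p. Proof. exact: prime_gt0. Qed.
Let pk_gt1 : 1 < p ^ k. Proof. by rewrite -(exp1n k) ltn_exp2r. Qed.

Lemma extension_groupP u :
  reflect (exists2 x, p %| x & (FinRing.uval u : nat) = x.+1)
          (u \in extension_group p k).
Proof.
rewrite !inE /=; apply: (iffP eqP) => [u1|[x p_x ->]].
  have u_gt0 : 0 < (FinRing.uval u : nat).
    by case: posnP u1 => // ->; rewrite mod0n modn_small.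
  exists (FinRing.uval u : nat).-1; last by rewrite prednK.
  by rewrite -subn1 -eqn_mod_dvd //; apply/eqP.
by apply/eqP; rewrite -addn1 -{2}(add0n 1) eqn_modDr mod0n.
Qed.

Lemma extension_group_expg_eq1 u j : u \in extension_group p k ->
  (u ^+ (p ^ j) == 1)%g = (p ^ (k - j) %| (FinRing.uval u : nat) - 1).
Proof.
case/extension_groupP=> x p_x ux.
rewrite (unit_Zp_expg_eq1 (a := x.+1)) // ?ux.
  by rewrite dvdn_expS_sub1 // subn1.
by rewrite -ux natr_Zp.
Qed.

Lemma uval_ltn u : (FinRing.uval u : nat) < p ^ k.
Proof. by rewrite -[X in _ < X]Zp_cast. Qed.

(** The index is the quotient by [p ^ (k - j)]. Injectivity bounds the size of [A] by [p ^ j]; when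
    that bound is attained, [f] is a bijection. *)
Lemma eq1_modn_index j (A : {set {unit 'Z_(p ^ k)}}) :
    j < k ->
    {in A, forall u, (FinRing.uval u : nat) = 1 %[mod p ^ (k - j)]} ->
  exists f : {unit 'Z_(p ^ k)} -> 'I_(p ^ j),
    {in A &, injective f} /\
    {in A, forall u, (FinRing.uval u : nat) = 1 + f u * p ^ (k - j)}.
Proof.
(* A modulus above 1 makes the remainder 1 rather than 0. *)
move=> j_lt A1; have pkj_gt1 : 1 < p ^ (k - j).
  by rewrite -(exp1n (k - j)) ltn_exp2r // subn_gt0.
have lt u : (FinRing.uval u : nat) %/ p ^ (k - j) < p ^ j.
  by rewrite ltn_divLR ?(ltnW pkj_gt1) // -expnD subnKC ?(ltnW j_lt) ?uval_ltn.
pose f u := Ordinal (lt u).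
have fE : {in A, forall u, (FinRing.uval u : nat) = 1 + f u * p ^ (k - j)}.
  move=> u /A1 u1; rewrite {1}(divn_eq (FinRing.uval u) (p ^ (k - j))) u1.
  by rewrite modn_small // addnC.
exists f; split=> // u v uA vA fuv.
by do 2!apply: val_inj; rewrite /= (fE u) // (fE v) // fuv.
Qed.

Lemma extension_group_eq1_modn u j : u \in extension_group p k ->
  (u ^+ (p ^ j) = 1)%g -> (FinRing.uval u : nat) = 1 %[mod p ^ (k - j)].
Proof.
move=> uB /eqP; rewrite extension_group_expg_eq1 // => dvd_u.
apply/eqP; rewrite eqn_mod_dvd //.
by case/extension_groupP: uB => x _ ->.
Qed.

Lemma card_extension_group_le : #|extension_group p k| <= p ^ k.-1.
Proof.
have k_pred : k.-1 < k by rewrite prednK.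
have [|f [f_inj _]] := eq1_modn_index (A := extension_group p k) k_pred.
  move=> u; rewrite inE => /andP[_ /eqP].
  by have -> : k - k.-1 = 1 by lia.
by rewrite -(card_in_imset f_inj) -[X in _ <= X]card_ord max_card.
Qed.

Lemma extension_group_generator : exists2 g : {unit 'Z_(p ^ k)},
  FinRing.uval g = (p + 1)%:R%R & extension_group p k = <[g]>%g /\ #[g]%g = p ^ k.-1.
Proof.
have g_unit : (p + 1)%:R%R \is a @GRing.unit 'Z_(p ^ k).
  by rewrite unitZpE // coprimeXl // addn1 coprimenS.
pose g : {unit 'Z_(p ^ k)} := FinRing.Unit g_unit.
have gB : g \in extension_group p k.
  rewrite !inE /= val_Zp_nat // modn_dvdm ?modnDl //.
  by rewrite -{1}(expn1 p) dvdn_exp2l.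
(* Lifting the exponent at x = p: the condition is that [p ^ (k - j)] divides [p]. The least such
   [j] is [k.-1]. *)
have g_order j : (#[g]%g %| p ^ j) = (k - j <= 1).
  rewrite order_dvdn (unit_Zp_expg_eq1 (a := p + 1)) ?addn_gt0 ?p_gt0 //.
  by rewrite addn1 dvdn_expS_sub1 // -{2}(expn1 p) dvdn_Pexp2l.
have ord_g : #[g]%g = p ^ k.-1.
  have /(dvdn_pfactor _ _ p_prime)[m le_m ordE] : #[g]%g %| p ^ k.-1.
    by rewrite g_order; lia.
  have := g_order m; rewrite -ordE dvdnn => /esym k_m.
  by rewrite ordE; congr (p ^ _); lia.
exists g => //; split=> //; apply/esym/eqP.
(* The cyclic group lies in the extension group and already reaches the upper bound on its size. *)
rewrite eqEcard cycle_subG gB /=.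
by rewrite -[#|<[g]>%g|]/(#[g]%g) ord_g card_extension_group_le.
Qed.

Lemma sum_extension_subgroup j (S : {group {unit 'Z_(p ^ k)}}) :
    j < k -> S \subset extension_group p k -> #|S| = p ^ j ->
  \sum_(x in S) (FinRing.uval x : nat) = #|S| %[mod p ^ k].
Proof.
move=> j_lt /subsetP SB cardS.
have [|f [f_inj fE]] := eq1_modn_index (A := S) j_lt.
  (* By Lagrange, every element of [S] is killed by the exponent [p ^ j]. *)
  by move=> u uS; apply: extension_group_eq1_modn (SB u uS) _; rewrite -cardS expg_cardG.
(* An injection between sets of the same size [p ^ j] is onto, so every index occurs in the sum. *)
have fS : f @: S = setT.
  by apply/eqP; rewrite eqEcard subsetT cardsT card_ord card_in_imset ?cardS /=.
have -> : \sum_(x in S) (FinRing.uval x : nat)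
    = \sum_(i < p ^ j) (1 + i * p ^ (k - j)).
  rewrite (eq_bigr _ fE) -(big_imset (fun i : 'I__ => 1 + i * p ^ (k - j)) f_inj).
  by rewrite fS; apply: eq_bigl => i; rewrite inE.
rewrite big_split /= sum_nat_const card_ord muln1 -big_distrl /=.
(* The factor [p ^ j] of the sum of indices joins [p ^ (k - j)] to give [p ^ k], so only the sum of
   the ones survives. *)
rewrite sum_ord_odd ?oddX ?p_odd ?orbT // mulnAC -expnD subnKC ?(ltnW j_lt) //.
by rewrite addnC mulnC modnMDl cardS.
Qed.

End ExtensionGroup.

Theorem lemma1p4 (p k : nat) (p_prime : prime p) (p_odd : odd p)
    (k_ge1 : 1 <= k) :
  [/\ #|extension_group p k| = p ^ k.-1,
      exists2 g : {unit 'Z_(p ^ k)},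
        FinRing.uval g = (p + 1)%:R%R & extension_group p k = <[g]>%g
    & forall S : {group {unit 'Z_(p ^ k)}}, S \subset extension_group p k ->
        (exists2 s : nat, s < k & #|S| = #|extension_group p k| %/ p ^ s)
        /\ \sum_(x in S) (FinRing.uval x : nat) = #|S| %[mod p ^ k]].
Proof.
have [g gE [BE ord_g]] := extension_group_generator p_prime p_odd k_ge1.
have cardB : #|extension_group p k| = p ^ k.-1 by rewrite BE -ord_g.
split=> //; first by exists g.
move=> S SB.
have : #|S| %| p ^ k.-1 by rewrite -cardB cardSg.
case/(dvdn_pfactor _ _ p_prime)=> j le_j cardS.
split; last by apply: (@sum_extension_subgroup _ _ _ _ _ j); rewrite // -(prednK k_ge1).
exists (k.-1 - j); first by rewrite ltn_subLR //; lia.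
by rewrite cardB cardS -expnB ?prime_gt0 ?leq_subr // subKn.
Qed.
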